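(* Let $(s_n)$ be a convergent sequence in a generalized $\theta$-parametric metric space $(\mathcal{X},\mathfrak{P}_\theta,\theta)$. Then: (i) the limit of $(s_n)$ in $\mathcal{X}$ is unique; (ii) $(s_n)$ is a Cauchy sequence in $\mathcal{X}$.
   Context: A $\mathcal{B}$-action is a map $\theta:[0,\infty)^2\to[0,\infty)$, continuous in each variable, with image $\mathrm{Im}(\theta)$, such that: ($\mathcal{B}1$) $\theta(0,0)=0$ and $\theta(x,y)=\theta(y,x)$ for all $x,y\ge0$; ($\mathcal{B}2$) $\theta(x,y)<\theta(u,v)$ whenever either $x<u,\ y\le v$ or $x\le u,\ y<v$; ($\mathcal{B}3$) for each $r\in\mathrm{Im}(\theta)$ and each $x\in[0,r]$ there is $y\in[0,r]$ with $\theta(x,y)=r$; ($\mathcal{B}4$) $\theta(y,0)\le y$ for all $y>0$. $\mathfrak{F}$ is the set of functions $f:(0,\infty)\to\mathbb{R}$ such that $f$ is non-decreasing and, for every sequence $(\varepsilon_n)$ in $(0,\infty)$, $\lim\varepsilon_n=0$ if and only if $\lim f(\varepsilon_n)=-\infty$. Let $\mathcal{X}$ be a nonempty set and $\theta$ a $\mathcal{B}$-action. A generalized $\theta$-parametric metric on $\mathcal{X}$ is a function $\mathfrak{P}_\theta:\mathcal{X}\times\mathcal{X}\times(0,\infty)\to[0,\infty)$ that is symmetric ($\mathfrak{P}_\theta(x,y,p)=\mathfrak{P}_\theta(y,x,p)$) and satisfies: ($\mathfrak{P}_\theta1$) $\mathfrak{P}_\theta(x,y,p)=0$ for all $p>0$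 if and only if $x=y$; ($\mathfrak{P}_\theta2$) there exists $(f,\alpha)\in\mathfrak{F}\times[0,\infty)$ such that for all $s,p>0$ and $x,y,z\in\mathcal{X}$: if $\mathfrak{P}_\theta(x,y,r)>0$ for all $r>0$, then $f(\mathfrak{P}_\theta(x,y,s+p))\le f(\theta(\mathfrak{P}_\theta(x,z,s),\mathfrak{P}_\theta(z,y,p)))+\alpha$ (with the convention $f(0)=-\infty$). Then $(\mathcal{X},\mathfrak{P}_\theta,\theta)$ is called a generalized $\theta$-parametric metric space. A sequence $(s_n)$ in $\mathcal{X}$ converges to $s\in\mathcal{X}$ if for every $\epsilon>0$ and every $p>0$ there is $N(p)\in\mathbb{N}$ with $\mathfrak{P}_\theta(s_n,s,p)<\epsilon$ for all $n\ge N(p)$; it is Cauchy if for every $\epsilon>0$ and every $p>0$ there is $N(p)\in\mathbb{N}$ with $\mathfrak{P}_\theta(s_m,s_n,p)<\epsilon$ for all $m,n\ge N(p)$.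
   Formalization: In (P2) the inequality is required whenever P(x,y,r)>0 for some r>0 (i.e. for all distinct x,y), not only when P(x,y,r)>0 for all r>0; with the literal premise, limits need not be unique and convergent sequences need not be Cauchy. *)

(* Defs.v *)
From HB Require Import structures.
From mathcomp Require Import all_boot all_order all_algebra.
From mathcomp Require Import all_classical all_reals all_analysis.

Set Implicit Arguments.
Unset Strict Implicit.
Unset Printing Implicit Defensive.
Import Order.TTheory GRing.Theory Num.Theory.
Import numFieldNormedType.Exports.

Local Open Scope classical_set_scope.
Local Open Scope ring_scope.

(* Functions on [0, +oo[ or ]0, +oo[ are represented by functions on R of
   which only the restriction to that domain is ever constrained or used. *)

Definition image_action (R : realType) (theta : R -> R -> R) : set R :=
  [set theta x y | x in `[0, +oo[ & y in `[0, +oo[].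

Record is_B_action (R : realType) (theta : R -> R -> R) : Prop := {
  B_ge0 : forall x y : R, 0 <= x -> 0 <= y -> 0 <= theta x y ;
  B_continuousr : forall x : R, 0 <= x ->
    {within `[0, +oo[, continuous (fun y => theta x y)} ;
  B_continuousl : forall y : R, 0 <= y ->
    {within `[0, +oo[, continuous (fun x => theta x y)} ;
  B_zero : theta 0 0 = 0 ;
  B_sym : forall x y : R, 0 <= x -> 0 <= y -> theta x y = theta y x ;
  B_mono : forall x y u v : R, 0 <= x -> 0 <= y -> 0 <= u -> 0 <= v ->
    (x < u /\ y <= v) \/ (x <= u /\ y < v) -> theta x y < theta u v ;
  B_solve : forall r x : R, image_action theta r -> 0 <= x <= r ->
    exists2 y : R, 0 <= y <= r & theta x y = r ;
  B_le : forall y : R, 0 < y -> theta y 0 <= y }.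

Record class_F (R : realType) (f : R -> R) : Prop := {
  F_nondecreasing : forall x y : R, 0 < x -> x <= y -> f x <= f y ;
  F_cvg : forall e : nat -> R, (forall n, 0 < e n) ->
    (e n @[n --> \oo] --> (0 : R)) <-> (f (e n) @[n --> \oo] --> -oo) }.

Definition ext_F (R : realType) (f : R -> R) (t : R) : \bar R :=
  if 0 < t then (f t)%:E else -oo%E.

(* In P_triangle, "P x y r > 0 for all r > 0 implies" is read with r
   quantified over the whole implication.  Given P_eq0, the premise then
   amounts to x <> y.  Requiring instead P x y r to be positive at every r
   simultaneously would leave unconstrained any distinct x and y with
   P x y r = 0 for a single r, and limits would not be unique. *)
Record is_gen_parametric_metric (R : realType) (X : Type)
    (theta : R -> R -> R) (P : X -> X -> R -> R) : Prop := {
  P_inhabited : inhabited X ;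
  P_action : is_B_action theta ;
  P_ge0 : forall (x y : X) (p : R), 0 < p -> 0 <= P x y p ;
  P_sym : forall (x y : X) (p : R), 0 < p -> P x y p = P y x p ;
  P_eq0 : forall x y : X, (forall p : R, 0 < p -> P x y p = 0) <-> x = y ;
  P_triangle : exists (f : R -> R) (alpha : R),
    [/\ class_F f, 0 <= alpha &
      forall (r s p : R) (x y z : X), 0 < r -> 0 < s -> 0 < p ->
        0 < P x y r ->
        (ext_F f (P x y (s + p)%R) <=
           ext_F f (theta (P x z s) (P z y p)) + alpha%:E)%E] }.

Definition converges_to (R : realType) (X : Type) (P : X -> X -> R -> R)
    (s : nat -> X) (l : X) : Prop :=
  forall e p : R, 0 < e -> 0 < p ->
    exists N : nat, forall n, (N <= n)%N -> P (s n) l p < e.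

Definition is_cauchy (R : realType) (X : Type) (P : X -> X -> R -> R)
    (s : nat -> X) : Prop :=
  forall e p : R, 0 < e -> 0 < p ->
    exists N : nat, forall m n, (N <= m)%N -> (N <= n)%N ->
      P (s m) (s n) p < e.

(* Main.v *)
Require Import Defs.
From HB Require Import structures.
From mathcomp Require Import all_boot all_order all_algebra.
From mathcomp Require Import all_classical all_reals all_analysis.
From mathcomp Require Import lra.

Set Implicit Arguments.
Unset Strict Implicit.
Unset Printing Implicit Defensive.
Import Order.TTheory GRing.Theory Num.Theory.
Import numFieldNormedType.Exports.

Local Open Scope classical_set_scope.
Local Open Scope ring_scope.

(** Both claims follow from a weak, uniform substitute for the triangle
    inequality, [gen_parametric_small_triangle]: for every [e] there is [d],
    independent of the points and of the parameter, such that
    [P x z (p / 2) < d] and [P z y (p / 2) < d] force [P x y p < e].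
    Uniqueness is this with [z] a late term of the sequence between two limits,
    the Cauchy property is this with [z] the limit between two late terms.

    The substitute itself combines two facts.  First, [theta a b] is small
    when [a] and [b] are ([B_action_small]).  Second, because [f] tends to
    [-oo] at [0], adding the fixed constant [alpha] to [f u] cannot bring it up
    to [f e] once [u] is small enough ([class_F_gap]); so [P x y p >= e] would
    contradict the inequality relating [f (P x y p)] to
    [f (theta _ _) + alpha]. *)

(** Separate continuity suffices: since [theta (e / 2) 0 <= e / 2 < e],
    continuity in the second variable at [0] gives [c] with
    [theta (e / 2) b < e] for all [b < c], and monotonicity in the first
    variable extends this bound to every [a < e / 2]. *)
Lemma B_action_small (R : realType) (theta : R -> R -> R) (e : R) :
  is_B_action theta -> 0 < e ->
  exists2 d : R, 0 < d &
    forall a b : R, 0 <= a < d -> 0 <= b < d -> theta a b < e.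
Proof.
move=> Bt e0; have d0 : 0 < e / 2 by lra.
have lim0 : theta (e / 2) y @[y --> within `[0, +oo[ (nbhs (0 : R))]
    --> theta (e / 2) 0.
  have /subspace_continuousP := B_continuousr Bt (ltW d0).
  by apply; rewrite /= in_itv /= lexx.
have lt0 : theta (e / 2) 0 < e.
  by have := B_le Bt d0; lra.
have : \forall y \near within `[0, +oo[ (nbhs (0 : R)), theta (e / 2) y < e.
  exact: (cvgr_lt _ lim0).
rewrite near_withinE => /nbhs_ballP[c /= c0 cP].
exists (Num.min (e / 2) c); first by rewrite lt_min d0.
move=> a b /andP[a0]; rewrite lt_min => /andP[ad _].
move=> /andP[b0]; rewrite lt_min => /andP[_ bc].
apply: (@lt_trans _ _ (theta (e / 2) b)).
  by apply: (B_mono Bt) => //; [exact: ltW | left].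
apply: cP; last by rewrite /= in_itv /= b0.
by rewrite /ball /= sub0r normrN ger0_norm.
Qed.

(** The axiom on [f] is sequential; testing it on [1 / (n + 1)] and using
    monotonicity turns it into a statement on a whole interval at [0]. *)
Lemma class_F_gap (R : realType) (f : R -> R) (alpha e : R) :
  class_F f ->
  exists2 eta : R, 0 < eta & forall u : R, 0 < u <= eta -> f u + alpha < f e.
Proof.
move=> Ff.
have inv_gt0 n : 0 < (n.+1%:R : R)^-1 by rewrite invr_gt0.
have /cvgrNy_lt/(_ (f e - alpha)) [N _ NP] :=
  (F_cvg Ff inv_gt0).1 (@cvg_harmonic R).
exists (N.+1%:R^-1) => // u /andP[u0 uN].
have := F_nondecreasing Ff u0 uN; have := NP N (leqnn N) => /=; lra.
Qed.

(** When [u <= 0] the bound on [ext_F f t] is [-oo], which again excludes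
    [t >= e] because [f] is finite at positive reals. *)
Lemma ext_F_lt (R : realType) (f : R -> R) (alpha e : R) :
  class_F f -> 0 < e ->
  exists2 eta : R, 0 < eta & forall t u : R, u < eta ->
    (ext_F f t <= ext_F f u + alpha%:E)%E -> t < e.
Proof.
move=> Ff e0; have [eta eta0 etaP] := class_F_gap alpha e Ff.
exists eta => // t u ueta; rewrite ltNge => tu; apply/negP => et.
move: tu; rewrite /ext_F (lt_le_trans e0 et).
case: ifPn => [u0|_]; last by rewrite addNye.
rewrite -EFinD lee_fin.
have := F_nondecreasing Ff e0 et; have : f u + alpha < f e.
  by apply: etaP; rewrite u0 ltW.
lra.
Qed.

(** The triangle axiom may be used as soon as [P x y] is positive somewhere.
    Taking the parameter [p] itself as that place avoids deciding whether
    [x = y]: if [P x y p = 0], the bound already holds. *)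
Lemma gen_parametric_small_triangle (R : realType) (X : Type)
    (theta : R -> R -> R) (P : X -> X -> R -> R) (e : R) :
  is_gen_parametric_metric theta P -> 0 < e ->
  exists2 d : R, 0 < d & forall (x y z : X) (p : R), 0 < p ->
    P x z (p / 2) < d -> P z y (p / 2) < d -> P x y p < e.
Proof.
move=> PP e0; have [f [alpha [Ff _ tri]]] := P_triangle PP.
have [eta eta0 etaP] := ext_F_lt alpha Ff e0.
have [d d0 dP] := B_action_small (P_action PP) eta0.
exists d => // x y z p p0 xz zy; have p20 : 0 < p / 2 by lra.
have [xy0|xy0] := leP (P x y p) 0; first exact: le_lt_trans e0.
have := tri p (p / 2) (p / 2) x y z p0 p20 p20 xy0.
rewrite -splitr; apply: etaP.
by apply: dP; rewrite (P_ge0 PP).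
Qed.

Lemma converges_to_unique (R : realType) (X : Type) (theta : R -> R -> R)
    (P : X -> X -> R -> R) (s : nat -> X) (l l' : X) :
  is_gen_parametric_metric theta P ->
  converges_to P s l -> converges_to P s l' -> l = l'.
Proof.
move=> PP sl sl'; apply/(P_eq0 PP) => p p0; have p20 : 0 < p / 2 by lra.
apply/eqP; rewrite eq_le (P_ge0 PP) // andbT.
apply/ler_addgt0Pl => e e0; rewrite addr0; apply: ltW.
have [d d0 dP] := gen_parametric_small_triangle PP e0.
have [N NP] := sl _ _ d0 p20; have [N' NP'] := sl' _ _ d0 p20.
apply: (dP _ _ (s (maxn N N'))) => //.
  by rewrite (P_sym PP) //; apply: NP; rewrite leq_maxl.
by apply: NP'; rewrite leq_maxr.
Qed.

Lemma converges_to_cauchy (R : realType) (X : Type) (theta : R -> R -> R)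
    (P : X -> X -> R -> R) (s : nat -> X) (l : X) :
  is_gen_parametric_metric theta P -> converges_to P s l -> is_cauchy P s.
Proof.
move=> PP sl e p e0 p0; have p20 : 0 < p / 2 by lra.
have [d d0 dP] := gen_parametric_small_triangle PP e0.
have [N NP] := sl _ _ d0 p20; exists N => m n Nm Nn.
apply: (dP _ _ l) => //; first exact: NP.
by rewrite (P_sym PP) //; exact: NP.
Qed.

Theorem proposition3p19 (R : realType) (X : Type) (theta : R -> R -> R)
    (P : X -> X -> R -> R) (s : nat -> X) :
  is_gen_parametric_metric theta P ->
  (exists l : X, converges_to P s l) ->
  (exists! l : X, converges_to P s l) /\ is_cauchy P s.
Proof.
move=> PP [l sl]; split; last exact: converges_to_cauchy PP sl.
by exists l; split => // l'; exact: converges_to_unique PP sl.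
Qed.
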